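(* Let $p\geq 2$ be prime, let $n\geq 1$, and let $\mathcal B=\mathcal I_1\times\cdots\times\mathcal I_n$, where each $\mathcal I_j\subseteq\mathbb Z$ ($j\in[1,n]$) is a complete system of residues modulo $p$. Let $s\geq 1$ and let $m_1,\ldots,m_s\geq 0$ be integers, let $f_1,\ldots,f_s\in\mathbb Z[X_1,\ldots,X_n]$ be nonzero polynomials, and let $w_1(X),\ldots,w_s(X)\in\mathbb Q[X]$ be integer valued polynomials with respective degrees $t_1,\ldots,t_s\geq 0$. Let $$V=\{\mathbf a\in\mathcal B:\ f_i(\mathbf a)\equiv 0 \pmod{p^{m_i}}\text{ for all } i\in[1,s]\}\quad\text{and}\quad N=\sum_{\mathbf a\in V}\prod_{i=1}^s w_i\Big(\frac{f_i(\mathbf a)}{p^{m_i}}\Big).$$ If $m\geq 1$ is an integer with $$n>(m-1)\max_{i\in[1,s]}\Big\{1,\ \frac{\varphi(p^{m_i})}{p-1}\deg f_i\Big\}+\sum_{i=1}^s\frac{(t_i+1)p^{m_i}-1}{p-1}\deg f_i,$$ where $\varphi$ is Euler's totient function, then $N\equiv 0\pmod{p^m}$.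
   Context: A complete system of residues modulo $p$ is a set $\mathcal I\subseteq\mathbb Z$ with $|\mathcal I|=p$ whose elements are pairwise distinct modulo $p$. A polynomial $w\in\mathbb Q[X]$ is integer valued if $w(a)\in\mathbb Z$ for all $a\in\mathbb Z$. $[a,b]$ denotes the set of integers $x$ with $a\leq x\leq b$. $\varphi(1)=1$ and $\varphi(p^e)=(p-1)p^{e-1}$ for $e\geq1$. The convention $0^0=1$ is used. *)

(* Defs.v *)
From HB Require Import structures.
From mathcomp Require Import all_boot all_order all_algebra.
From mathcomp Require Import finmap mpoly.

Set Implicit Arguments.
Unset Strict Implicit.
Unset Printing Implicit Defensive.

Import Order.TTheory GRing.Theory Num.Theory.
Local Open Scope fset_scope.
Local Open Scope ring_scope.

Definition complete_residue_system (p : nat) (I : {fset int}) : Prop :=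
  #|` I| = p /\ {in I &, forall x y : int, (x = y %[mod p])%Z -> x = y}.

Definition integer_valued (w : {poly rat}) : Prop :=
  forall a : int, w.[a%:~R] \is a Num.int.

(* The total degree; the junk value at 0 is 0. *)
Definition total_degree (n : nat) (f : {mpoly int[n]}) : nat := (msize f).-1.

(* The Cartesian product of the I j, as a set of integer vectors. *)
Definition box (n : nat) (I : 'I_n -> {fset int}) : {fset {ffun 'I_n -> int}} :=
  [fset [ffun j => fsval (a j)] | a : {dffun forall j : 'I_n, I j} in predT].

Lemma in_box (n : nat) (I : 'I_n -> {fset int}) (a : {ffun 'I_n -> int}) :
  (a \in box I) = [forall j, a j \in I j].
Proof.
apply/imfsetP/forallP => [[b _ ->] j|aI]; first by rewrite ffunE fsvalP.
exists [ffun j => [` aI j]] => //.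
by apply/ffunP => j; rewrite !ffunE.
Qed.

Definition solutions (p n s : nat) (I : 'I_n -> {fset int}) (d : 'I_s -> nat)
    (f : 'I_s -> {mpoly int[n]}) : {fset {ffun 'I_n -> int}} :=
  [fset a in box I | [forall i, ((f i).@[a] == 0 %[mod (p ^ d i)%N])%Z]].

Definition weighted_count (p n s : nat) (I : 'I_n -> {fset int})
    (d : 'I_s -> nat) (f : 'I_s -> {mpoly int[n]}) (w : 'I_s -> {poly rat}) :
    rat :=
  \sum_(a <- solutions p I d f)
    \prod_(i < s) (w i).[((f i).@[a])%:~R / (p ^ d i)%:R].

(* The seed 1 of the maximum is the constant 1 in max_i {1, ...}.  Division is
   rational: for d i = 0 the quotients are 1 / (p - 1) and t i / (p - 1), not always
   integers. *)
Definition degree_bound (p n s : nat) (d : 'I_s -> nat) (t : 'I_s -> nat)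
    (f : 'I_s -> {mpoly int[n]}) (m : nat) : rat :=
  (m%:R - 1) * (\big[Num.max/1]_(i < s)
    ((totient (p ^ d i))%:R / (p%:R - 1) * (total_degree (f i))%:R))
  + \sum_(i < s)
      (((t i)%:R + 1) * (p ^ d i)%:R - 1) / (p%:R - 1)
        * (total_degree (f i))%:R.

(* Main.v *)
(* Write the function h : x |-> [p^d | x] w(x / p^d) as a Newton series sum_k c_k C(x, k).
   It is killed by (E^(p^d) - 1)^(t+1), E being the shift and t = deg w, and in Z[E] the
   power (E - 1)^k lies in the ideal (p^r, (E^(p^d) - 1)^(t+1)) as soon as
   k >= (t+1) p^d + (r-1) phi(p^d); hence p^r divides c_k = ((E - 1)^k h)(0) for such k
   (a weighted Fleck-Weisman congruence).

   On the other hand the sum over the box of an integer-valued function of degree D is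
   divisible by p^(n - floor(D / (p-1))): summation over a complete residue system
   is an operator in the ideal ((E_j - 1)^(p-1), p), and more than D / (p-1) factors
   (E_j - 1)^(p-1) annihilate the function.

   Expanding N in the products prod_i C(f_i(a), k_i), each term either has enough p
   in its Newton coefficients or has small degree sum_i k_i deg f_i, and the
   hypothesis on n makes the two contributions add up to p^m. *)

Require Import Defs.
From HB Require Import structures.
From mathcomp Require Import all_boot all_order all_algebra.
From mathcomp Require Import finmap mpoly.
From mathcomp Require Import ring lra zify.

Set Implicit Arguments.
Unset Strict Implicit.
Unset Printing Implicit Defensive.

Import Order.TTheory GRing.Theory Num.Theory.
Local Open Scope ring_scope.

(** * Powers of ['X - 1] modulo powers of p and of ['X^q - 1] *)

(* For P = p, H Phi = 'X^(p^(e+1)) - 1 and x, y powers of 'X - 1, this says how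
   deep a power of 'X - 1 lies in (p^(r+1), ('X^(p^(e+1)) - 1)^T). The ideals (H, P)
   and (Phi, P) contain x and y, and Phi lies in (H, P), so excess factors Phi can be
   traded for factors P or H. *)
Section IdealPower.

Variables (R : comNzRingType) (P H Phi Q C B x y : R) (T r : nat).
Hypotheses (PhiE : Phi = P + H * Q) (xE : x = H + P * C) (yE : y = Phi + P * B).

Let J (z : R) : Prop := exists u v, z = P ^+ r.+1 * u + (H * Phi) ^+ T * v.

Let J_mull z u : J z -> J (u * z).
Proof. by case=> a [b ->]; exists (u * a), (u * b); ring. Qed.

Let J_add z u : J z -> J u -> J (z + u).
Proof. by case=> a [b ->] [c [d ->]]; exists (a + c), (b + d); ring. Qed.

Let J_left a : (r < a)%N -> forall z, J (z * P ^+ a).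
Proof. by move/subnK => <- z; exists (z * P ^+ (a - r.+1)), 0; rewrite exprD; ring. Qed.

Let J_right a b : (T <= a)%N -> (T <= b)%N -> forall z, J (z * (H ^+ a * Phi ^+ b)).
Proof.
move=> /subnK <- /subnK <- z.
by exists 0, (z * (H ^+ (a - T) * Phi ^+ (b - T))); rewrite !exprD exprMn; ring.
Qed.

(** Replacing an excess factor [Phi] by [P + H * Q] keeps the total exponent. When none is left,
    either [H] and [Phi] both have exponent at least [T], or the exponent of [P] exceeds [r]. *)
Let J_high_Phi k a c : (T + r <= a + k + c)%N ->
  J (H ^+ a * Phi ^+ (T + k) * P ^+ c).
Proof.
elim: k a c => [|k IH] a c le_r.
  have [aT|aT] := leqP T a.
    by rewrite mulrC; apply: J_right => //; rewrite addn0.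
  by apply: J_left; lia.
have -> : H ^+ a * Phi ^+ (T + k.+1) * P ^+ c
   = H ^+ a * Phi ^+ (T + k) * P ^+ c.+1
     + Q * (H ^+ a.+1 * Phi ^+ (T + k) * P ^+ c).
  by rewrite addnS !exprS {1}PhiE; ring.
by apply: J_add; [|apply: J_mull]; apply: IH; lia.
Qed.

Let J_monomial a b c : (a <= T)%N -> (T + T + r <= a + b + c)%N ->
  J (H ^+ a * Phi ^+ b * P ^+ c).
Proof.
move=> aT le_r; have [bT|bT] := leqP T b.
  by rewrite -(subnKC bT); apply: J_high_Phi; lia.
have [ab|ab] := ltnP (a + b) (T + T); first by apply: J_left; lia.
by lia.
Qed.

Lemma mem_ideal_of_powers :
  exists u v, x ^+ T * y ^+ (T + r) = P ^+ r.+1 * u + (H * Phi) ^+ T * v.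
Proof.
(* Expanding an [x] or a [y] trades it for one of [H], [Phi], [P], so the total exponent stays at
   least 2T + r. Only [x] produces [H], hence the invariant [a + k <= T]. *)
suff JJ k l a b c : (a + k <= T)%N -> (T + T + r <= a + b + c + k + l)%N ->
    J (H ^+ a * Phi ^+ b * P ^+ c * x ^+ k * y ^+ l).
  by have := JJ T (T + r)%N 0 0 0 (leqnn _); rewrite !expr0 !mul1r; apply; lia.
elim: k a b c => [|k IHk] a b c aT le_r.
  rewrite expr0 mulr1 addn0 in aT le_r *.
  elim: l b c le_r => [|l IHl] b c le_r.
    by rewrite expr0 mulr1; apply: J_monomial; lia.
  have -> : H ^+ a * Phi ^+ b * P ^+ c * y ^+ l.+1
     = H ^+ a * Phi ^+ b.+1 * P ^+ c * y ^+ l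
       + B * (H ^+ a * Phi ^+ b * P ^+ c.+1 * y ^+ l).
    by rewrite !exprS {1}yE; ring.
  by apply: J_add; [|apply: J_mull]; apply: IHl; lia.
have -> : H ^+ a * Phi ^+ b * P ^+ c * x ^+ k.+1 * y ^+ l
   = H ^+ a.+1 * Phi ^+ b * P ^+ c * x ^+ k * y ^+ l
     + C * (H ^+ a * Phi ^+ b * P ^+ c.+1 * x ^+ k * y ^+ l).
  by rewrite !exprS {1}xE; ring.
by apply: J_add; [|apply: J_mull]; apply: IHk; lia.
Qed.

End IdealPower.

Lemma map_poly_intr_eq0P (p : nat) (P : {poly int}) : prime p ->
  map_poly (intr : int -> 'F_p) P = 0 -> exists B, P = p%:R * B.
Proof.
move=> p_prime P0.
have /polyOver_dvdzP[B ->] : P \is a polyOver (dvdz p).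
  apply/polyOverP => i; rewrite (dvdz_pcharf (pchar_Fp p_prime)).
  by have /polyP/(_ i) := P0; rewrite coef_map coef0 => ->.
by exists B; rewrite -[Posz p]intz scaler_int mulr_natl pmulrn.
Qed.

Lemma eq_map_poly_intr (p : nat) (P Q : {poly int}) : prime p ->
  map_poly (intr : int -> 'F_p) P = map_poly (intr : int -> 'F_p) Q ->
  exists B, P = Q + p%:R * B.
Proof.
move=> p_prime eqPQ; have [||B PQ] := @map_poly_intr_eq0P p (P - Q) => //.
  by rewrite rmorphB /= eqPQ subrr.
by exists B; rewrite -PQ; ring.
Qed.

Section CharP.

Variables (p : nat) (p_prime : prime p).

Let pcharFpX : p \in [pchar {poly 'F_p}].
Proof. by rewrite pchar_poly; apply: pchar_Fp. Qed.

Lemma subX1_exp_prime_power e : ('X - 1 : {poly 'F_p}) ^+ (p ^ e) = 'X^(p ^ e) - 1.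
Proof.
elim: e => [|e IH]; first by rewrite expn0 !expr1.
rewrite expnSr exprM IH -(pFrobenius_autE pcharFpX) rmorphB rmorph1 /=.
by rewrite pFrobenius_autE -exprM.
Qed.

Lemma subX1_exp_predp (e : nat) :
  ('X - 1 : {poly 'F_p}) ^+ (p.-1 * p ^ e) = \sum_(i < p) ('X^(p ^ e)) ^+ i.
Proof.
have nz : ('X^(p ^ e) - 1 : {poly 'F_p}) != 0.
  by rewrite monic_neq0 // monic_Xn_sub_1 // expn_gt0 prime_gt0.
apply: (mulfI nz); rewrite -subrX1 -exprM -expnSr -!subX1_exp_prime_power -exprD.
by rewrite -mulSn prednK ?prime_gt0 // -expnS.
Qed.

End CharP.

(** For z = X^(p^e), take H = z - 1 and Phi = 1 + z + ... + z^(p-1), whose product is X^(p^(e+1)) -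
    1. Modulo p they equal x = (X - 1)^(p^e) and y = (X - 1)^((p-1)p^e), and x^T y^(T+r) is the
    power in question. *)
Lemma exp_subX1_mod_ideal (p e T r : nat) : prime p ->
  exists A B : {poly int},
    ('X - 1) ^+ (T * p ^ e.+1 + r * (p.-1 * p ^ e))
    = p%:R ^+ r.+1 * A + B * ('X^(p ^ e.+1) - 1) ^+ T.
Proof.
move=> p_prime; pose z : {poly int} := 'X^(p ^ e).
have [C xE] : exists C, ('X - 1) ^+ (p ^ e) = z - 1 + p%:R * C.
  apply: eq_map_poly_intr => //; rewrite !(rmorphB, rmorphXn) /= map_polyX.
  by rewrite !rmorph1 subX1_exp_prime_power.
have [B yE] : exists B, ('X - 1) ^+ (p.-1 * p ^ e) = \sum_(i < p) z ^+ i + p%:R * B.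
  apply: eq_map_poly_intr => //; rewrite !(rmorphB, rmorphXn) /= map_polyX.
  rewrite rmorph1 subX1_exp_predp // rmorph_sum; apply: eq_bigr => i _.
  by rewrite !rmorphXn /= map_polyX.
have PhiE : \sum_(i < p) z ^+ i =
    p%:R + (z - 1) * \sum_(i < p) \sum_(j < i) z ^+ j.
  rewrite big_distrr /= -[p in p%:R]card_ord -sum1_card natr_sum -big_split.
  by apply: eq_bigr => i _ /=; rewrite -subrX1 subrKC.
have [u [v uv]] := mem_ideal_of_powers T r PhiE xE yE.
exists u, v; rewrite [v * _]mulrC expnS [(p * _)%N]mulnC exprM subrX1 -uv -!exprM -exprD.
congr (_ ^+ _); have pE := esym (prednK (prime_gt0 p_prime)).
by move: (p ^ e)%N p.-1 pE => E q ->; ring.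
Qed.

(** * Newton coefficients as values of a linear functional *)

(* The linear functional 'X^i |-> h i: multiplying the polynomial by 'X^q - 1 turns
   h into its q-step difference, so ('X - 1)^k yields the k-th Newton coefficient. *)
Definition umbral (h : nat -> rat) (P : {poly int}) : rat :=
  \sum_(i < size P) (P`_i)%:~R * h i.

Lemma umbral_wide (h : nat -> rat) (P : {poly int}) (k : nat) : (size P <= k)%N ->
  umbral h P = \sum_(i < k) (P`_i)%:~R * h i.
Proof.
move=> le_k; rewrite /umbral (big_ord_widen k (fun i => (P`_i)%:~R * h i) le_k).
rewrite big_mkcond; apply: eq_bigr => i _ /=.
by case: ltnP => // ?; rewrite nth_default // mul0r.
Qed.

Lemma eq_umbral (h g : nat -> rat) (P : {poly int}) :
  h =1 g -> umbral h P = umbral g P.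
Proof. by move=> hg; apply: eq_bigr => i _; rewrite hg. Qed.

Fact umbral_is_zmod_morphism (h : nat -> rat) : zmod_morphism (umbral h).
Proof.
move=> P Q; set k := maxn (maxn (size P) (size Q)) (size (P - Q)).
rewrite !(@umbral_wide h _ k) ?leq_max ?leqnn ?orbT // -sumrB.
by apply: eq_bigr => i _; rewrite coefB rmorphB mulrBl.
Qed.

HB.instance Definition _ (h : nat -> rat) :=
  GRing.isZmodMorphism.Build {poly int} rat (umbral h) (umbral_is_zmod_morphism h).

Lemma umbralMn (h : nat -> rat) (P : {poly int}) (k : nat) :
  umbral h (k%:R * P) = k%:R * umbral h P.
Proof. by rewrite !mulr_natl raddfMn. Qed.

Lemma umbral_int (h : nat -> rat) (P : {poly int}) :
  (forall i, h i \is a Num.int) -> umbral h P \is a Num.int.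
Proof. by move=> hZ; apply: rpred_sum => i _; rewrite rpredM // intr_int. Qed.

Lemma umbralMXn (h : nat -> rat) (P : {poly int}) (q : nat) :
  umbral h (P * 'X^q) = umbral (fun i => h (i + q)%N) P.
Proof.
rewrite (@umbral_wide h _ (q + size P)).
  rewrite big_split_ord /= big1 ?add0r => [|i _].
    by apply: eq_bigr => i _; rewrite coefMXn ltnNge leq_addr /= addKn addnC.
  by rewrite coefMXn ltn_ord mul0r.
by have := size_polyMleq P 'X^q; rewrite size_polyXn; lia.
Qed.

Lemma umbralXn (h : nat -> rat) (q : nat) : umbral h 'X^q = h q.
Proof.
by rewrite -['X^q]mul1r umbralMXn /umbral size_poly1 big_ord1 coef1 mul1r.
Qed.

Definition fdiff (q : nat) (h : nat -> rat) (i : nat) : rat := h (i + q)%N - h i.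

Lemma umbral_fdiff (h : nat -> rat) (P : {poly int}) (q : nat) :
  umbral h (P * ('X^q - 1)) = umbral (fdiff q h) P.
Proof.
rewrite mulrBr mulr1 raddfB /= umbralMXn /umbral -sumrB.
by apply: eq_bigr => i _; rewrite -mulrBr.
Qed.

Lemma umbral_iter_fdiff (h : nat -> rat) (P : {poly int}) (q T : nat) :
  umbral h (P * ('X^q - 1) ^+ T) = umbral (iter T (fdiff q) h) P.
Proof.
elim: T h => [|T IH] h; first by rewrite mulr1.
by rewrite exprSr mulrA umbral_fdiff IH iterSr.
Qed.

(** This is the image of the binomial expansion of X^x = ((X - 1) + 1)^x. Terms with k > x vanish,
    so any K > x serves. *)
Lemma newton_expansion (h : nat -> rat) (K x : nat) : (x < K)%N ->
  h x = \sum_(k < K) 'C(x, k)%:R * umbral h (('X - 1) ^+ k).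
Proof.
move=> xK; rewrite -[LHS]umbralXn.
have -> : 'X^x = ('X - 1 + 1 : {poly int}) ^+ x by rewrite subrK.
rewrite exprD1n.
rewrite (big_ord_widen K (fun k => ('X - 1) ^+ k *+ 'C(x, k)) xK) raddf_sum /=.
rewrite big_mkcond; apply: eq_bigr => k _ /=.
case: ltnP => [_|xk]; first by rewrite raddfMn mulr_natl.
by rewrite bin_small // mul0r.
Qed.

(** * Divisibility of the Newton coefficients of a dilated polynomial *)

Definition dilate (q : nat) (w : {poly rat}) (x : nat) : rat :=
  if (q %| x)%N then w.[(x %/ q)%:R] else 0.

Definition delta_poly (w : {poly rat}) : {poly rat} := w \Po ('X + 1) - w.

(** [w \Po ('X + 1)] has the size and the leading coefficient of [w], so the top terms cancel. *)
Lemma size_delta_poly (w : {poly rat}) (T : nat) :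
  (size w <= T.+1)%N -> (size (delta_poly w) <= T)%N.
Proof.
move=> wT; apply/leq_sizeP => j Tj; rewrite /delta_poly.
have szX : size ('X + 1 : {poly rat}) = 2%N by rewrite size_XaddC.
have szw : size (w \Po ('X + 1)) = size w by rewrite size_comp_poly2.
rewrite coefB; have [wj|wj] := leqP (size w) j.
  by rewrite !nth_default ?szw // subrr.
have -> : j = (size w).-1 by lia.
rewrite -[in X in X - _]szw -!/(lead_coef _) lead_coef_comp ?szX //.
by rewrite lead_coefDl ?size_poly1 ?size_polyX // lead_coefX expr1n mulr1 subrr.
Qed.

Lemma fdiff_dilate (q : nat) (w : {poly rat}) : (0 < q)%N ->
  fdiff q (dilate q w) =1 dilate q (delta_poly w).
Proof.
move=> q0 x; rewrite /fdiff /dilate dvdn_addl //.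
case: ifP => qx; last by rewrite subrr.
rewrite /delta_poly hornerD hornerN horner_comp !hornerE divnDr // divnn q0.
by rewrite natrD.
Qed.

Lemma iter_fdiff_dilate (q T : nat) (w : {poly rat}) : (0 < q)%N ->
  (size w <= T)%N -> iter T (fdiff q) (dilate q w) =1 fun=> 0.
Proof.
move=> q0; suff gen h : h =1 dilate q w -> (size w <= T)%N ->
  iter T (fdiff q) h =1 fun=> 0 by apply: gen.
elim: T h w => [|T IH] h w hw wT.
  move: wT; rewrite leqn0 size_poly_eq0 => /eqP w0 x.
  by rewrite /= hw w0 /dilate horner0 if_same.
rewrite iterSr; apply: (IH _ (delta_poly w)) (size_delta_poly wT) => x.
by rewrite -fdiff_dilate // /fdiff !hw.
Qed.

Lemma umbral_dilate_ideal (q T : nat) (w : {poly rat}) (B : {poly int}) :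
  (0 < q)%N -> (size w <= T)%N ->
  umbral (dilate q w) (B * ('X^q - 1) ^+ T) = 0.
Proof.
move=> q0 wT; rewrite umbral_iter_fdiff /umbral big1 // => i _.
by rewrite iter_fdiff_dilate // mulr0.
Qed.

(** From k = T p^d on, [exp_subX1_mod_ideal] splits (X - 1)^k into a multiple of a power of p and a
    multiple of (X^(p^d) - 1)^T, which the functional kills. *)
Lemma newton_coef_dilate_dvd (p d T k : nat) (w : {poly rat}) : prime p ->
  (forall x : nat, w.[x%:R] \is a Num.int) -> (size w <= T)%N ->
  exists r, umbral (dilate (p ^ d) w) (('X - 1) ^+ k) / p%:R ^+ r \is a Num.int
    /\ (k < T * p ^ d + r * totient (p ^ d))%N.
Proof.
move=> p_prime wZ wT; have p0 := prime_gt0 p_prime.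
have hZ x : dilate (p ^ d) w x \is a Num.int by rewrite /dilate; case: ifP.
have [kT|Tk] := ltnP k (T * p ^ d).
  by exists 0; rewrite divr1 addn0; split=> //; apply: umbral_int.
case: d hZ Tk => [|e] hZ Tk.
  (* For d = 0 the shift has step 1 and (X - 1)^k itself kills the function: the coefficient is 0,
     and [k.+1] is simply large enough for the bound. *)
  rewrite expn0 muln1 in hZ Tk *; exists k.+1; split; last by rewrite muln1; lia.
  rewrite -['X]expr1 -(subnK Tk) exprD umbral_dilate_ideal ?mul0r //.
set phi := totient _; set q := (p ^ e.+1)%N in hZ Tk *.
have phi0 : (0 < phi)%N by rewrite totient_gt0 expn_gt0 p0.
have phiE : phi = (p.-1 * p ^ e)%N by rewrite /phi totient_pfactor.
(* One more than the quotient: the ideal lemma at r yields p^(r+1), and the remainder lies below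
   [phi], which makes the bound strict. *)
exists ((k - T * q) %/ phi).+1; set r := (_ %/ _)%N; split; last first.
  have := ltn_ceil (k - T * q) phi0; rewrite -/r; lia.
have kE : k = ((k - T * q) %% phi + (T * q + r * phi))%N.
  by rewrite addnCA [(_ %% _ + _)%N]addnC -divn_eq subnKC.
have [A [B AB]] := exp_subX1_mod_ideal e T r p_prime.
rewrite kE exprD phiE AB mulrDr [_ * (B * _)]mulrA raddfD /=.
rewrite umbral_dilate_ideal ?expn_gt0 ?p0 // addr0 mulrCA -natrX umbralMn natrX.
by rewrite mulrC mulKf ?umbral_int // expf_neq0 // pnatr_eq0 -lt0n.
Qed.

(** * Degree measured by finite differences *)

Section FiniteDegree.

Variable n : nat.
Implicit Types (F G : {ffun 'I_n -> int} -> rat) (a : {ffun 'I_n -> int}).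

Definition unit_vec (j : 'I_n) : {ffun 'I_n -> int} := [ffun i => (i == j)%:R].

Definition pdiff (j : 'I_n) F a : rat := F (a + unit_vec j) - F a.

(* Degree < D in the sense of finite differences; D = 0 means F = 0. *)
Fixpoint deglt (D : nat) F : Prop :=
  if D is D'.+1 then forall j, deglt D' (pdiff j F) else forall a, F a = 0.

Lemma eq_deglt D F G : F =1 G -> deglt D F -> deglt D G.
Proof.
elim: D F G => [|D IH] F G FG /=; first by move=> F0 a; rewrite -FG.
by move=> dF j; apply: (IH _ _ _ (dF j)) => a; rewrite /pdiff !FG.
Qed.

Lemma degltS D F : deglt D F -> deglt D.+1 F.
Proof.
elim: D F => [|D IH] F /= dF j; last exact: IH.
by move=> a; rewrite /pdiff !dF subrr.
Qed.

Lemma deglt_leq D E F : (D <= E)%N -> deglt D F -> deglt E F.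
Proof.
move=> /subnK <- dF; elim: (E - D)%N => // k IH; rewrite addSn; exact: degltS.
Qed.

Lemma deglt_zero D : deglt D (fun=> 0).
Proof. by apply: (@deglt_leq 0). Qed.

Lemma degltD D F G : deglt D F -> deglt D G -> deglt D (fun a => F a + G a).
Proof.
elim: D F G => [|D IH] F G /= dF dG => [a|j]; first by rewrite dF dG addr0.
by apply: eq_deglt (IH _ _ (dF j) (dG j)) => a; rewrite /pdiff; ring.
Qed.

Lemma degltZ D c F : deglt D F -> deglt D (fun a => c * F a).
Proof.
elim: D F => [|D IH] F /= dF => [a|j]; first by rewrite dF mulr0.
by apply: eq_deglt (IH _ (dF j)) => a; rewrite /pdiff; ring.
Qed.

Lemma deglt_sum D (K : Type) (r : seq K) (F : K -> {ffun 'I_n -> int} -> rat) :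
  (forall k, deglt D (F k)) -> deglt D (fun a => \sum_(k <- r) F k a).
Proof.
move=> dF; elim: r => [|k r IH].
  by apply: eq_deglt (deglt_zero D) => a; rewrite big_nil.
by apply: eq_deglt (degltD (dF k) IH) => a; rewrite big_cons.
Qed.

Lemma deglt_shift D v F : deglt D F -> deglt D (fun a => F (a + v)).
Proof.
elim: D F => [|D IH] F /= dF => [a|j]; first exact: dF.
by apply: eq_deglt (IH _ (dF j)) => a; rewrite /pdiff addrAC.
Qed.

(** Discrete Leibniz rule, by induction on D + E. If D or E is 0, that factor has zero difference
    and its term disappears. *)
Lemma degltM D E F G : deglt D.+1 F -> deglt E.+1 G ->
  deglt (D + E).+1 (fun a => F a * G a).
Proof.
have [k] := ubnP (D + E).
elim: k D E F G => // k IH D E F G DEk dF dG j.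
apply: (@eq_deglt _ (fun a => pdiff j F a * G (a + unit_vec j) + F a * pdiff j G a)).
  by move=> a; rewrite /pdiff; ring.
have dG' := deglt_shift (unit_vec j) dG.
apply: degltD.
  case: D dF DEk => [|D] dF DEk; last by apply: IH => //; lia.
  by apply: eq_deglt (deglt_zero _) => a; rewrite (dF j) mul0r.
case: E dG DEk {dG'} => [|E] dG DEk; last by rewrite plusE addnS; apply: IH => //; lia.
by apply: eq_deglt (deglt_zero _) => a; rewrite (dG j) mulr0.
Qed.

Lemma deglt_cst c : deglt 1 (fun=> c).
Proof. by move=> j a; rewrite /pdiff subrr. Qed.

Lemma deglt_coord i : deglt 2 (fun a => (a i)%:~R).
Proof. by move=> j k a; rewrite /pdiff !ffunE !rmorphD /=; ring. Qed.

Lemma deglt_prod (K : Type) (r : seq K) (D : K -> nat)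
    (F : K -> {ffun 'I_n -> int} -> rat) :
  (forall k, deglt (D k).+1 (F k)) ->
  deglt (\sum_(k <- r) D k).+1 (fun a => \prod_(k <- r) F k a).
Proof.
move=> dF; elim: r => [|k r IH].
  by rewrite big_nil; apply: eq_deglt (deglt_cst 1) => a; rewrite big_nil.
rewrite big_cons; apply: eq_deglt (degltM (dF k) IH) => a.
by rewrite big_cons.
Qed.

Lemma deglt_exp D F k : deglt D.+1 F -> deglt (k * D).+1 (fun a => F a ^+ k).
Proof.
move=> dF; rewrite -[k in (k * D)%N]card_ord -sum_nat_const.
have := deglt_prod (index_enum 'I_k) (fun=> dF).
by apply: eq_deglt => a; rewrite prodr_const card_ord.
Qed.

Lemma deglt_meval (f : {mpoly int[n]}) :
  deglt (total_degree f).+1 (fun a => (f.@[a])%:~R).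
Proof.
pose F (m : 'X_{1..n}) (a : {ffun 'I_n -> int}) : rat :=
  (f@_m)%:~R * \prod_(i < n) (a i)%:~R ^+ m i.
apply: (@eq_deglt _ (fun a => \sum_(m <- msupp f) F m a)).
  move=> a; rewrite mevalE rmorph_sum; apply: eq_bigr => m _.
  rewrite /F rmorphM rmorph_prod; congr (_ * _).
  by apply: eq_bigr => i _; rewrite rmorphXn.
(* [deglt_sum] asks for a bound at every index, so monomials outside the support get the zero
   function. *)
apply: (@eq_deglt _ (fun a => \sum_(m <- msupp f) if m \in msupp f then F m a else 0)).
  by move=> a; apply: eq_big_seq => m ->.
apply: deglt_sum => m; case: (boolP (m \in _)) => mf; last exact: deglt_zero.
have mD : (mdeg m <= total_degree f)%N.
  by have := msize_mdeg_lt mf; rewrite /total_degree; lia.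
apply: (@deglt_leq (mdeg m).+1) => //; apply: degltZ.
rewrite mdegE; apply: deglt_prod => i.
by have := deglt_exp (m i) (deglt_coord i); rewrite muln1.
Qed.

(** The binomial coefficient as a polynomial: differences leave the box, where the argument may be
    negative. *)
Definition binr (k : nat) (x : rat) : rat := (\prod_(u < k) (x - u%:R)) / k`!%:R.

Lemma deglt_binr D F k : deglt D.+1 F -> deglt (k * D).+1 (fun a => binr k (F a)).
Proof.
move=> dF; rewrite -[k in (k * D)%N]card_ord -sum_nat_const.
have dFu (u : 'I_k) : deglt D.+1 (fun a => F a - u%:R).
  by apply: degltD dF _; apply: deglt_leq (deglt_cst _).
apply: eq_deglt (degltZ (k`!%:R)^-1 (deglt_prod (index_enum 'I_k) dFu)) => a.
by rewrite mulrC.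
Qed.

End FiniteDegree.

(** * Values of binomial polynomials *)

Lemma binr_nat (k x : nat) : binr k x%:R = 'C(x, k)%:R.
Proof.
have k0 : k`!%:R != 0 :> rat by rewrite pnatr_eq0 -lt0n fact_gt0.
apply/(canLR (mulfK k0)); rewrite -natrM bin_ffact.
elim: k {k0} => [|k IH]; first by rewrite big_ord0.
rewrite big_ord_recr /= IH ffactnSr natrM; have [kx|xk] := leqP k x.
  by rewrite natrB.
by rewrite ffact_small // !mul0r.
Qed.

Lemma binr_pascal (k : nat) (x : rat) : binr k.+1 (x + 1) = binr k.+1 x + binr k x.
Proof.
have k0 : k`!%:R != 0 :> rat by rewrite pnatr_eq0 -lt0n fact_gt0.
have k1 : k.+1%:R != 0 :> rat by rewrite pnatr_eq0.
rewrite /binr big_ord_recl big_ord_recr /= factS natrM subr0.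
rewrite (eq_bigr (fun u : 'I_k => x - u%:R)); last first.
  by move=> u _; rewrite /bump /= add1n -addn1 natrD; ring.
set q := \prod_(_ < _) _; move: k0 k1; rewrite -addn1 natrD => k0 k1.
by field; rewrite k0 k1.
Qed.

(** Pascal's rule carries integrality from 0 upwards and, read backwards, downwards. *)
Lemma binr_int (k : nat) (x : int) : binr k x%:~R \is a Num.int.
Proof.
elim: k x => [|k IH] x; first by rewrite /binr big_ord0 fact0 divr1.
elim/int_ind: x => [|x IHx|x IHx].
- by rewrite (binr_nat k.+1 0).
- by rewrite intS addrC rmorphD /= binr_pascal rpredD.
move: (IHx); rewrite intS addrC opprD.
have -> : (- x%:Z)%:~R = (- x%:Z - 1)%:~R + 1 :> rat by rewrite rmorphB /= subrK.
rewrite binr_pascal => H; rewrite -(addrK (binr k (- x%:Z - 1)%:~R) (binr _ _)).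
by rewrite rpredB.
Qed.

(** * Sums over complete residue systems and over boxes *)

Lemma residue_perm (p : nat) (s : seq nat) : (0 < p)%N -> size s = p ->
  {in s &, forall x y, x = y %[mod p] -> x = y} -> uniq s ->
  perm_eq [seq (x %% p)%N | x <- s] (iota 0 p).
Proof.
move=> p0 sp s_inj us.
have um : uniq [seq (x %% p)%N | x <- s] by rewrite map_inj_in_uniq.
apply: uniq_perm => //; first exact: iota_uniq.
apply: (uniq_min_size um _ _).2; last by rewrite size_map size_iota sp.
by move=> _ /mapP[x _ ->]; rewrite mem_iota ltn_mod.
Qed.

(* Mod p, and modulo 'X^p - 1 = ('X - 1)^p, the sum is 1 + 'X + ... + 'X^(p-1). *)
Lemma sum_exp_residues (p : nat) (s : seq nat) : prime p -> size s = p ->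
  {in s &, forall x y, x = y %[mod p] -> x = y} -> uniq s ->
  exists A B : {poly int},
    \sum_(x <- s) 'X^x = A * ('X - 1) ^+ p.-1 + p%:R * B.
Proof.
move=> p_prime sp s_inj us; have p0 := prime_gt0 p_prime.
have [B yE] : exists B : {poly int}, ('X - 1) ^+ p.-1 = \sum_(i < p) 'X^i + p%:R * B.
  apply: (@eq_map_poly_intr p) => //; rewrite !(rmorphB, rmorphXn) /= map_polyX.
  have := subX1_exp_predp p_prime 0; rewrite expn0 muln1 rmorph1 => ->.
  rewrite rmorph_sum; apply: eq_bigr => i _.
  by rewrite !rmorphXn /= map_polyX.
(* Each X^x differs from X^(x mod p) by a multiple of X^p - 1, which is X - 1 times the sum of the
   X^i with i < p. *)
have -> : \sum_(x <- s) 'X^x = (1 + ('X - 1) * \sum_(x <- s)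
    'X^(x %% p) * \sum_(i < x %/ p) 'X^p ^+ i) * \sum_(i < p) 'X^i :> {poly int}.
  rewrite mulrDl mul1r mulrAC -subrX1 mulr_sumr.
  have -> : \sum_(i < p) 'X^i = \sum_(x <- s) 'X^(x %% p) :> {poly int}.
    rewrite -(big_mkord xpredT (fun i => 'X^i)) /index_iota subn0.
    by rewrite -(perm_big _ (residue_perm p0 sp s_inj us)) big_map.
  rewrite -big_split; apply: eq_bigr => x _ /=.
  by rewrite mulrCA -subrX1 -exprM mulrBr mulr1 -exprD subrKC mulnC addnC -divn_eq.
set D := 1 + _; exists D, (- (D * B)); rewrite yE; ring.
Qed.

Lemma unit_vecMz (n : nat) (i j : 'I_n) (x : int) :
  (unit_vec j *~ x) i = if i == j then x else 0.
Proof.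
have -> : unit_vec j *~ x = [ffun i => if i == j then x else 0].
  have nat_case (k : nat) : unit_vec j *+ k = [ffun i => if i == j then k%:Z else 0].
    apply/ffunP => k'; rewrite ffunMnE !ffunE; case: eqP => _; last by rewrite mul0rn.
    by rewrite pmulrn intz.
  apply/ffunP => k; case: x => x; first by rewrite -pmulrn nat_case.
  by rewrite NegzE -nmulrn nat_case !ffunE; case: eqP; rewrite ?oppr0.
by rewrite ffunE.
Qed.

Section BoxSum.

Variables (p n : nat) (p_prime : prime p) (s : 'I_n -> seq int).
Hypothesis size_s : forall j, size (s j) = p.
Hypothesis uniq_s : forall j, uniq (s j).
Hypothesis s_inj : forall j, {in s j &, forall x y : int, (x = y %[mod p])%Z -> x = y}.

Lemma iter_fdiff_line (F : {ffun 'I_n -> int} -> rat) (j : 'I_n) b (T : nat) :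
  iter T (fdiff 1) (fun i => F (b + unit_vec j *+ i))
  =1 fun i => iter T (pdiff j) F (b + unit_vec j *+ i).
Proof.
elim: T => //= T IH i; rewrite /fdiff !IH /pdiff.
by rewrite addn1 mulrSr addrA.
Qed.

(** [sum_exp_residues] is read through the functional along direction j; the shift by M makes all
    exponents natural. A, B and M do not depend on F or a, so the identity can be summed over the
    other coordinates. *)
Lemma line_sum (j : 'I_n) : exists A B : {poly int}, exists M : nat,
  forall F a, \sum_(x <- s j) F (a + unit_vec j *~ x)
  = umbral (fun i => iter p.-1 (pdiff j) F (a - unit_vec j *+ M + unit_vec j *+ i)) A
    + p%:R * umbral (fun i => F (a - unit_vec j *+ M + unit_vec j *+ i)) B.
Proof.
pose M := (\sum_(x <- s j) absz x)%N.
have sM x : x \in s j -> x + M%:Z = absz (x + M%:Z).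
  move=> xs; have : (absz x <= M)%N by rewrite /M (big_rem x) //= leq_addr.
  by lia.
have [||||A [B AB]] := @sum_exp_residues p [seq absz (x + M%:Z) | x <- s j] => //.
- by rewrite size_map.
- move=> _ _ /mapP[x xs ->] /mapP[y ys ->] eqxy.
  congr (absz (_ + _)); apply: (s_inj xs ys); apply/eqP.
  by rewrite -(eqz_modDr M%:Z) (sM x xs) (sM y ys) !modz_nat eqxy.
- rewrite map_inj_in_uniq ?uniq_s // => x y xs ys eqxy.
  by apply: (addIr M%:Z); rewrite (sM x xs) (sM y ys) eqxy.
exists A, B, M => F a.
set b := a - _.
have -> : \sum_(x <- s j) F (a + unit_vec j *~ x) =
    umbral (fun i => F (b + unit_vec j *+ i)) (A * ('X - 1) ^+ p.-1 + p%:R * B).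
  rewrite -AB big_map raddf_sum; apply: eq_big_seq => x xs /=.
  rewrite umbralXn pmulrn -sM // /b; congr F.
  by rewrite mulrzDr -pmulrn addrA addrAC subrK.
rewrite raddfD /= umbralMn -['X]expr1 umbral_iter_fdiff; congr (_ + _).
by apply: eq_umbral => i; rewrite iter_fdiff_line.
Qed.

Lemma int_iter_pdiff (F : {ffun 'I_n -> int} -> rat) (j : 'I_n) T :
  (forall a, F a \is a Num.int) -> forall a, iter T (pdiff j) F a \is a Num.int.
Proof. by move=> FZ; elim: T => //= T IH a; rewrite rpredB. Qed.

Lemma deglt_iter_pdiff D (F : {ffun 'I_n -> int} -> rat) (j : 'I_n) T :
  deglt D F -> deglt (D - T) (iter T (pdiff j) F).
Proof.
move=> dF; elim: T => [|T IH]; first by rewrite subn0.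
rewrite subnS; case: (D - T)%N IH => //= IH a.
by rewrite /pdiff !IH subrr.
Qed.

Lemma deglt_umbral D (F : {ffun 'I_n -> int} -> rat) (j : 'I_n) v P :
  deglt D F -> deglt D (fun a => umbral (fun i => F (a - v + unit_vec j *+ i)) P).
Proof.
move=> dF; apply: deglt_sum => i; apply: degltZ.
apply: eq_deglt (deglt_shift (unit_vec j *+ i - v) dF) => a.
by rewrite -addrA [_ - v]addrC.
Qed.

(** Coordinates outside l are 0 and get filled one at a time, so that the sum over the box can be
    treated by induction on l. *)
Fixpoint partial_box (l : seq 'I_n) : seq {ffun 'I_n -> int} :=
  if l is j :: l' then [seq a + unit_vec j *~ x | a <- partial_box l', x <- s j]
  else [:: 0].

(** By [line_sum], each coordinate either lowers the degree bound by p - 1 or supplies a factor p.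
    As D bounds the degree strictly, for D > 0 the hypothesis says r <= |l| - floor((D - 1) / (p -
    1)). *)
Lemma sum_partial_box_dvd (l : seq 'I_n) (D r : nat) (F : {ffun 'I_n -> int} -> rat) :
  (forall a, F a \is a Num.int) -> deglt D F ->
  (D + p.-1 * r <= p.-1 * (size l).+1)%N ->
  (\sum_(a <- partial_box l) F a) / p%:R ^+ r \is a Num.int.
Proof.
have p1 : (0 < p.-1)%N by have := prime_gt1 p_prime; lia.
have pZ k : p%:R ^+ k != 0 :> rat by rewrite expf_neq0 // pnatr_eq0 -lt0n prime_gt0.
have sumZ l' F' : (forall a, F' a \is a Num.int) -> \sum_(a <- l') F' a \is a Num.int.
  by move=> F'Z; apply: rpred_sum.
elim: l D r F => [|j l IH] D r F FZ dF Dr.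
  case: r Dr => [|r] Dr; first by rewrite divr1 sumZ.
  have D0 : D = 0 by move: Dr; rewrite /=; nia.
  by rewrite big1 ?mul0r // => a _; move: dF; rewrite D0 => ->.
have [/= dF0|D0] := posnP D.
  by rewrite big1 ?mul0r // => a _; move: dF; rewrite dF0 => ->.
case: r Dr => [|r] Dr; first by rewrite divr1 sumZ.
rewrite /= big_allpairs_dep /=.
have [A [B [M ABM]]] := line_sum j.
rewrite (eq_bigr _ (fun a _ => ABM F a)) big_split /= mulrDl -mulr_sumr.
apply: rpredD.
  apply: (IH (D - p.-1)%N).
  - by move=> a; apply: umbral_int => i; apply: int_iter_pdiff.
  - by apply: deglt_umbral; apply: deglt_iter_pdiff.
  (* If D < p - 1 the subtraction truncates to 0; the bound then comes from D > 0, which makes this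
     inequality strict. *)
  - have rl : (r.+1 < (size l).+2)%N.
      by rewrite -(ltn_pmul2l p1); move: Dr; rewrite /=; lia.
    have := leq_mul (leqnn p.-1) rl; move: Dr; rewrite /= !mulnS; lia.
rewrite exprS -mulf_div divff ?mul1r; last exact: (pZ 1%N).
apply: (IH D).
- by move=> a; apply: umbral_int.
- exact: deglt_umbral.
- by move: Dr; rewrite /=; nia.
Qed.

Lemma mem_partial_box (l : seq 'I_n) (a : {ffun 'I_n -> int}) : uniq l ->
  (a \in partial_box l) = [forall j, if j \in l then a j \in s j else a j == 0].
Proof.
elim: l a => [|j l IH] a.
  move=> _; rewrite inE; apply/eqP/forallP => [-> j|a0]; first by rewrite ffunE.
  by apply/ffunP => j; rewrite ffunE; apply/eqP.
move=> /= /andP[jl ul]; apply/allpairsP/forallP => [[[b x] /= [bl xs ->]] i|al].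
  move: bl; rewrite IH // => /forallP/(_ i).
  rewrite inE ffunE unit_vecMz; case: (eqVneq i j) => [->|_] /=.
    by rewrite (negPf jl) => /eqP ->; rewrite add0r.
  by rewrite addr0.
pose b : {ffun 'I_n -> int} := [ffun i => if i == j then 0 else a i].
exists (b, a j); split => /=.
- rewrite IH //; apply/forallP => i; rewrite ffunE.
  case: eqP => [->|/eqP ij]; first by rewrite (negPf jl).
  by have := al i; rewrite inE (negPf ij).
- by have := al j; rewrite inE eqxx.
- apply/ffunP => i; rewrite !ffunE unit_vecMz.
  by case: eqP => [->|_]; rewrite ?add0r ?addr0.
Qed.

Lemma uniq_partial_box (l : seq 'I_n) : uniq l -> uniq (partial_box l).
Proof.
elim: l => //= j l IH /andP[jl ul]; apply: allpairs_uniq => //; first exact: IH.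
move=> [a x] [b y] /allpairsP[[a' x'] [al xs [-> ->]]]
  /allpairsP[[b' y'] [bl ys [-> ->]]] /=.
move: al bl; rewrite /= !mem_partial_box // => /forallP/(_ j) + /forallP/(_ j).
rewrite (negPf jl) => /eqP aj0 /eqP bj0 eqab.
have xy : x' = y'.
  by move/ffunP: (eqab) => /(_ j); rewrite !ffunE !unit_vecMz eqxx aj0 bj0 !add0r.
by move: eqab; rewrite xy => /addIr ->.
Qed.

End BoxSum.

Lemma sum_box_dvd (p n : nat) (I : 'I_n -> {fset int}) (D r : nat)
    (F : {ffun 'I_n -> int} -> rat) : prime p ->
  (forall j, complete_residue_system p (I j)) ->
  (forall a, F a \is a Num.int) -> deglt D F ->
  (D + p.-1 * r <= p.-1 * n.+1)%N ->
  (\sum_(a <- box I) F a) / p%:R ^+ r \is a Num.int.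
Proof.
move=> p_prime crsI FZ dF Dr; pose s j : seq int := enum_fset (I j).
have sI j : size (s j) = p by have [] := crsI j.
have us j : uniq (s j) by exact: fset_uniq.
have s_inj j : {in s j &, forall x y : int, (x = y %[mod p])%Z -> x = y}.
  by have [_] := crsI j.
rewrite (perm_big (partial_box s (enum 'I_n))) /=; last first.
  apply: uniq_perm; rewrite ?fset_uniq ?uniq_partial_box ?enum_uniq // => a.
  rewrite mem_partial_box ?enum_uniq // in_box; apply: eq_forallb => j.
  by rewrite mem_enum.
by apply: (sum_partial_box_dvd p_prime) dF _ => //; rewrite size_enum_ord.
Qed.

(** * Expansion of the weights and the final count *)

(* The shift by p^d C makes the argument a natural number, where the Newton
   expansion is exact. *)
Lemma weight_expansion (d p C K : nat) (w : {poly rat}) (z : int) :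
  (0 < p)%N -> 0 <= z + (p ^ d * C)%N -> z + (p ^ d * C)%N < K ->
  (if (z == 0 %[mod (p ^ d)%N])%Z then w.[z%:~R / (p ^ d)%:R] else 0)
  = \sum_(k < K) binr k (z + (p ^ d * C)%N)%:~R
      * umbral (dilate (p ^ d) (w \Po ('X - C%:R%:P))) (('X - 1) ^+ k).
Proof.
move=> p0; set q := (p ^ d)%N; have q0 : (0 < q)%N by rewrite expn_gt0 p0.
case yE : (z + (q * C)%N) => [y|//] _ yK.
rewrite (eq_bigr (fun k : 'I_K => 'C(y, k)%:R *
    umbral (dilate q (w \Po ('X - C%:R%:P))) (('X - 1) ^+ k))); last first.
  by move=> k _; rewrite -pmulrn binr_nat.
rewrite -newton_expansion // /dilate.
have -> : (z == 0 %[mod q])%Z = (q %| y)%N.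
  rewrite -(eqz_modDr (q * C)%N) yE add0r !modz_nat modnMr.
  by rewrite /dvdn; apply/eqP/eqP => [[]|->].
case: ifP => // qy; rewrite horner_comp !hornerE; congr (_.[_]).
have q0' : q%:R != 0 :> rat by rewrite pnatr_eq0 -lt0n.
apply/(canLR (mulfK q0')); rewrite mulrBl -!natrM divnK //.
have -> : z = y%:Z - (q * C)%:Z by lia.
by rewrite rmorphB /= [(C * q)%N]mulnC.
Qed.

(** Each k_i is at most (t_i + 1) p^(d_i) - 1 + r_i phi(p^(d_i)). After multiplication by deg f_i /
    (p - 1), the r_i parts cost at most R times the maximum. The other m - 1 - R powers cost 1 each,
    hence no more than the maximum, which is at least 1. *)
Lemma degree_count (p n s : nat) (d t : 'I_s -> nat) (f : 'I_s -> {mpoly int[n]})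
    (m : nat) (k r : 'I_s -> nat) : prime p ->
  n%:R > degree_bound p d t f m ->
  (forall i, (k i < (t i).+1 * p ^ d i + r i * totient (p ^ d i))%N) ->
  (\sum_i r i < m)%N ->
  ((\sum_i k i * total_degree (f i)).+1 + p.-1 * (m - \sum_i r i) <= p.-1 * n.+1)%N.
Proof.
move=> p_prime; rewrite /degree_bound; set Mx := \big[_/_]_(_ < _) _.
move=> n_large kr rm; set R := (\sum_i r i)%N in rm *.
have p1 : 0 < p.-1%:R :> rat by rewrite ltr0n; have := prime_gt1 p_prime; lia.
have pE : p%:R - 1 = p.-1%:R :> rat.
  by rewrite -{1}(prednK (prime_gt0 p_prime)) -addn1 natrD addrK.
rewrite pE in Mx n_large.
have Mx1 : 1 <= Mx by apply: bigmax_ge_id.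
have Mxi i : (totient (p ^ d i))%:R / p.-1%:R * (total_degree (f i))%:R <= Mx.
  by rewrite /Mx; apply: (le_bigmax _ (fun i => _)).
have D_le : (\sum_i k i * total_degree (f i))%:R / p.-1%:R <=
  \sum_(i < s) (((t i)%:R + 1) * (p ^ d i)%:R - 1) / p.-1%:R * (total_degree (f i))%:R
  + R%:R * Mx :> rat.
  rewrite natr_sum mulr_suml /R natr_sum mulr_suml -big_split; apply: ler_sum => i _ /=.
  rewrite natrM.
  have ki : (k i)%:R <= ((t i)%:R + 1) * (p ^ d i)%:R - 1
      + (r i)%:R * (totient (p ^ d i))%:R :> rat.
    by have := kr i; rewrite -(ler_nat rat) -natr1 natrD !natrM -natr1; lra.
  have := ler_wpM2l (ler0n rat (r i)) (Mxi i).
  have g0 : 0 <= (total_degree (f i))%:R / p.-1%:R :> rat by rewrite divr_ge0.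
  have := ler_wpM2r g0 ki.
  lra.
rewrite ler_pdivrMr // in D_le.
set X := (\sum_i k i * _)%N in D_le *; have [e mE] : exists e, m = (e + R).+1.
  by exists (m - R.+1)%N; lia.
suff: (X + p.-1 * e < p.-1 * n)%N by rewrite mE mulnS subSn ?leq_addl // addnK mulnS; lia.
have e_le : e%:R <= e%:R * Mx :> rat by rewrite ler_peMr.
rewrite mE -natr1 natrD addrK in n_large.
rewrite -(ltr_nat rat) natrD !natrM [_ * n%:R]mulrC [_ * e%:R]mulrC.
apply: le_lt_trans (lerD D_le (lexx _)) _; rewrite -mulrDl ltr_pM2r //.
by apply: le_lt_trans n_large; lra.
Qed.

Theorem theorem1p3 (p : nat) (p_prime : prime p) (n : nat) (n_gt0 : (0 < n)%N)
  (I : 'I_n -> {fset int})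
  (I_crs : forall j : 'I_n, complete_residue_system p (I j))
  (s : nat) (s_gt0 : (0 < s)%N) (d : 'I_s -> nat)
  (f : 'I_s -> {mpoly int[n]}) (f_neq0 : forall i : 'I_s, f i != 0)
  (t : 'I_s -> nat) (w : 'I_s -> {poly rat})
  (w_int : forall i : 'I_s, integer_valued (w i))
  (w_deg : forall i : 'I_s, size (w i) = (t i).+1)
  (m : nat) (m_gt0 : (0 < m)%N)
  (n_large : n%:R > degree_bound p d t f m) :
  exists2 N : int,
    weighted_count p I d f w = N%:~R & (N = 0 %[mod (p ^ m)%N])%Z.
Proof.
have p0 := prime_gt0 p_prime.
have pR k : p%:R ^+ k != 0 :> rat by rewrite expf_neq0 // pnatr_eq0 -lt0n.
suff /intrP[N NE] : weighted_count p I d f w / p%:R ^+ m \is a Num.int.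
  exists (N * (p ^ m)%N); last by rewrite modzMl mod0z.
  by rewrite rmorphM /= -NE -pmulrn natrX divfK.
(* C bounds every |f_i(a)| on the box, so the shifted values f_i(a) + p^(d_i) C are nonnegative and
   less than K. *)
pose C := (\sum_(a <- box I) \sum_(i < s) absz (f i).@[a])%N.
pose K := (C + (\sum_(i < s) p ^ d i) * C).+1.
have C_ge (a : {ffun 'I_n -> int}) i : a \in box I -> (absz (f i).@[a] <= C)%N.
  by move=> aI; rewrite /C (big_rem a) //= (bigD1 i) //= -addnA leq_addr.
have q_le i : (p ^ d i <= \sum_(i < s) p ^ d i)%N.
  by rewrite [leqRHS](bigD1 i) //= leq_addr.
pose y i (a : {ffun 'I_n -> int}) : rat := ((f i).@[a] + (p ^ d i * C)%N)%:~R.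
pose c i k := umbral (dilate (p ^ d i) (w i \Po ('X - C%:R%:P))) (('X - 1) ^+ k).
have -> : weighted_count p I d f w =
    \sum_(k : {ffun 'I_s -> 'I_K}) (\prod_i c i (k i)) *
      \sum_(a <- box I) \prod_i binr (k i) (y i a).
  rewrite /weighted_count /solutions big_fset /= big_mkcond /=.
  under [RHS]eq_bigr do rewrite mulr_sumr.
  rewrite exchange_big; apply: eq_big_seq => a aI /=.
  under [RHS]eq_bigr do rewrite -big_split /=.
  rewrite -(bigA_distr_bigA (fun i (k : 'I_K) => c i k * binr k (y i a))).
  have wE i := @weight_expansion (d i) p C K (w i) (f i).@[a] p0.
  (* The indicator of the solution set is the product of the indicators of the single
     congruences. *)
  transitivity (\prod_(i < s) (if ((f i).@[a] == 0 %[mod (p ^ d i)%N])%Z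
      then (w i).[(f i).@[a]%:~R / (p ^ d i)%:R] else 0)).
    case: ifP => [/forallP fa0|/negbT].
      by apply: eq_bigr => i _; rewrite fa0.
    rewrite negb_forall => /existsP[i fi].
    by rewrite (bigD1 i) //= (negPf fi) mul0r.
  apply: eq_bigr => i _; rewrite wE.
  - by apply: eq_bigr => k _; rewrite mulrC.
  - have := C_ge a i aI; have : (0 < p ^ d i)%N by rewrite expn_gt0 p0.
    by move: (p ^ d i)%N (f i).@[a] => q z; nia.
  - have := C_ge a i aI; have := q_le i; rewrite /K.
    by move: (p ^ d i)%N (f i).@[a] (\sum_(_ < _) _)%N => q z Q; nia.
rewrite mulr_suml; apply: rpred_sum => k _.
have wi_int i (x : nat) : (w i \Po ('X - C%:R%:P)).[x%:R] \is a Num.int.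
  rewrite horner_comp !hornerE.
  by have := w_int i (x%:Z - C%:Z); rewrite rmorphB.
have [r r_dvd] := fin_all_exists (fun i => newton_coef_dilate_dvd (d i) (k i)
  p_prime (wi_int i) (leqnn _)).
set R := (\sum_i r i)%N.
have c_dvd : (\prod_i c i (k i)) / p%:R ^+ R \is a Num.int.
  rewrite /R -prodrXr -prodf_div; apply: rpred_prod => i _.
  by have [] := r_dvd i.
set b := \sum_(_ <- _) _.
(* If R >= m the Newton coefficients alone supply p^m; otherwise the sum over the box must supply
   the missing p^(m-R). *)
have [mR|Rm] := leqP m R.
  have bZ : b \is a Num.int.
    by apply: rpred_sum => a _; apply: rpred_prod => i _; apply: binr_int.
  have -> : (\prod_i c i (k i)) * b / p%:R ^+ m =
      (\prod_i c i (k i)) / p%:R ^+ R * p%:R ^+ (R - m) * b.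
    by rewrite -{1}(subnK mR) exprD; field; rewrite !pR.
  by apply: rpredM => //; apply: rpredM => //; rewrite rpredX ?rpred_nat.
have -> : (\prod_i c i (k i)) * b / p%:R ^+ m =
    (\prod_i c i (k i)) / p%:R ^+ R * (b / p%:R ^+ (m - R)).
  by rewrite mulf_div -exprD subnKC // ltnW.
apply: rpredM => //; apply: (sum_box_dvd p_prime I_crs)
  (degree_count p_prime n_large _ Rm).
- by move=> a; apply: rpred_prod => i _; apply: binr_int.
- apply: deglt_prod => i; apply: deglt_binr.
  rewrite /y.
  apply: (@eq_deglt _ _ (fun a => (f i).@[a]%:~R + (p ^ d i * C)%:R)).
    by move=> a; rewrite rmorphD.
  apply: degltD; first exact: deglt_meval.
  exact: deglt_leq (deglt_cst _).
(* T was the size of the shifted weight; composing with X - C preserves the size, so T = t_i + 1. *)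
- move=> i; have [_] := r_dvd i.
  by rewrite size_comp_poly2 ?size_XsubC // w_deg.
Qed.
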